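(* Every connected simple graph $G$ on $n\ge 2$ vertices with minimum degree $\delta$ has $O((n/\delta)^2)$ non-trivial min-cuts, and hence $n+O((n/\delta)^2)$ min-cuts (at most this many; the constants in the $O$-notation are absolute).
   Context: All graphs are finite. For a graph $G=(V,E)$, a cut is a set $\emptyset\neq X\subsetneq V$; its size is the number of edges with exactly one endvertex in $X$. A cut $X$ is trivial if $|X|=1$ or $|V\setminus X|=1$, and non-trivial otherwise. A min-cut is a cut of minimum size among all cuts of $G$. When counting, a cut $X$ and its complement $V\setminus X$ are regarded as the same cut (equivalently, one counts the sets of edges crossing the cuts). *)

(* Defs.v *)
From mathcomp Require Import all_boot all_order all_algebra.

Set Implicit Arguments.
Unset Strict Implicit.
Unset Printing Implicit Defensive.

(* A finite simple graph is a finite vertex type T with a symmetric and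
   irreflexive adjacency relation e. *)

Definition simple_graph (T : finType) (e : rel T) : Prop :=
  symmetric e /\ irreflexive e.

Definition connected_graph (T : finType) (e : rel T) : Prop :=
  forall x y : T, connect e x y.

Definition degree (T : finType) (e : rel T) (x : T) : nat :=
  #|[set y | e x y]|.

(* The default value #|T| exceeds every degree when e is irreflexive, so it
   only matters for the graph without vertices. *)
Definition min_degree (T : finType) (e : rel T) : nat :=
  \big[minn/#|T|]_(x : T) degree e x.

(* Edges are unordered pairs of adjacent vertices. *)
Definition edges (T : finType) (e : rel T) : {set {set T}} :=
  [set [set p.1; p.2] | p : T * T & e p.1 p.2].

Definition is_cut (T : finType) (X : {set T}) : bool :=
  (X != set0) && (X \proper [set: T]).

Definition crossing (T : finType) (e : rel T) (X : {set T}) : {set {set T}} :=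
  [set f in edges e | #|f :&: X| == 1].

Definition cut_size (T : finType) (e : rel T) (X : {set T}) : nat :=
  #|crossing e X|.

Definition is_min_cut (T : finType) (e : rel T) (X : {set T}) : bool :=
  is_cut X && [forall Y : {set T}, is_cut Y ==> (cut_size e X <= cut_size e Y)].

Definition trivial_cut (T : finType) (X : {set T}) : bool :=
  (#|X| == 1) || (#|~: X| == 1).

(* A cut and its complement are the same cut: each cut X is counted through
   the unordered pair {X, ~: X}. *)
Definition unoriented (T : finType) (X : {set T}) : {set {set T}} :=
  [set X; ~: X].

Definition min_cuts (T : finType) (e : rel T) : {set {set {set T}}} :=
  [set unoriented X | X : {set T} & is_min_cut e X].

Definition nontrivial_min_cuts (T : finType) (e : rel T) :
    {set {set {set T}}} :=
  [set unoriented X | X : {set T} & is_min_cut e X && ~~ trivial_cut X].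

(* Main.v *)
Require Import Defs.
From mathcomp Require Import all_boot all_order all_algebra zify ring.

(* Let d be the minimum degree and lam <= d the size of a minimum cut.  As the
   graph is simple, counting the degrees inside a set shows that each side of a
   non-trivial minimum cut has at least d vertices, and that X :\: W has at
   least d / 2 vertices whenever W is three steps below X in a chain of minimum
   cuts.  Hence a laminar family of non-trivial minimum cuts has O(n / d)
   members.  If d >= 3, uncrossing shows that a maximal cross-free family of
   non-trivial minimum cuts separates every pair of vertices that some
   non-trivial minimum cut separates, so non-trivial minimum cuts are unions of
   O(n / d) classes of vertices.  Karger's contraction argument, applied to the
   multigraph on these classes, bounds their number by O((n / d)^2).  If d <= 2,
   the same argument on the vertices themselves suffices. *)

Set Implicit Arguments.
Unset Strict Implicit.
Unset Printing Implicit Defensive.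

(** * Cuts as sets of arcs: submodularity and degree counts *)

Section Cuts.
Variables (T : finType) (e : rel T).
Hypotheses (e_sym : symmetric e) (e_irr : irreflexive e).
Implicit Types X Y Z : {set T}.

(* The arcs leaving X, each edge being a pair of opposite arcs: a crossing edge
   is counted once. *)
Definition dicut X : {set T * T} :=
  [set p | [&& e p.1 p.2, p.1 \in X & p.2 \notin X]].

(** The endpoint in [X] orients a crossing edge, so crossing edges and arcs leaving [X] correspond
    one to one; irreflexivity makes every edge a pair of distinct vertices. *)
Lemma cut_size_dicut X : cut_size e X = #|dicut X|.
Proof.
rewrite /cut_size.
have -> : crossing e X = [set [set p.1; p.2] | p in dicut X].
  apply/setP=> f; apply/idP/imsetP.
    rewrite inE => /andP[/imsetP[[x y] /= exy ->]].
    rewrite inE /= in exy.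
    have xy : x != y by apply: contraTneq exy => ->; rewrite e_irr.
    case: (boolP (x \in X)) (boolP (y \in X)) => [xX|xX] [yX|yX].
    - rewrite (_ : _ :&: _ = [set x; y]) ?cards2 ?xy //.
      by apply/setIidPl/subsetP=> z /set2P[] ->.
    - by move=> _; exists (x, y); rewrite // inE exy xX yX.
    - by move=> _; exists (y, x); rewrite 1?setUC // inE e_sym exy xX yX.
    - rewrite (_ : _ :&: _ = set0) ?cards0 //.
      apply/setP=> z; rewrite !inE; apply/negP=> /andP[/orP[] /eqP -> zX].
        by rewrite zX in xX.
      by rewrite zX in yX.
  case=> -[x y] /=; rewrite !inE /= => /and3P[exy xX yX] ->; apply/andP; split.
    by apply/imsetP; exists (x, y); rewrite ?inE.
  apply/cards1P; exists x; apply/setP=> z; rewrite !inE.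
  case: (z =P x) => [->|_] //=; case: (z =P y) => [->|] //=.
  by rewrite (negbTE yX).
rewrite card_in_imset // => -[x y] [x' y']; rewrite !inE /=.
move=> /and3P[_ xX yX] /and3P[_ x'X y'X] /setP E.
have ne a b : a \in X -> b \notin X -> (a == b) = false.
  by move=> aX bX; apply: contraNF bX => /eqP <-.
have:= E x; rewrite !inE eqxx (ne x y') // orbF => /esym /eqP ->.
have:= E y; rewrite !inE eqxx orbT eq_sym (ne x' y) //= => /esym /eqP ->.
by [].
Qed.

Lemma dicutE X :
  #|dicut X| = \sum_(p : T * T) [&& e p.1 p.2, p.1 \in X & p.2 \notin X].
Proof.
by rewrite -sum1_card big_mkcond; apply: eq_bigr => p _; rewrite inE; case: ifP.
Qed.

Lemma dicutC X : #|dicut (~: X)| = #|dicut X|.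
Proof.
have swapK : involutive (fun p : T * T => (p.2, p.1)) by case.
rewrite -(card_imset (dicut X) (inv_inj swapK)).
apply: eq_card => -[x y]; rewrite !inE /= negbK.
apply/idP/imsetP => [/and3P[exy xX yX]|[[a b]]].
  by exists (y, x); rewrite // inE /= e_sym exy yX xX.
by rewrite inE /= => /and3P[eab aX bX] [-> ->]; rewrite e_sym eab aX bX.
Qed.

(** Submodularity of the cut function, which holds arc by arc. *)
Lemma dicut_submod X Y :
  #|dicut (X :&: Y)| + #|dicut (X :|: Y)| <= #|dicut X| + #|dicut Y|.
Proof.
rewrite !dicutE -!big_split /=; apply: leq_sum => -[x y] _ /=; rewrite !inE.
by case: (e x y); case: (x \in X); case: (x \in Y); case: (y \in X); case: (y \in Y).
Qed.

Lemma dicut_setI X Y : #|dicut (X :&: Y)| <= #|dicut X| + #|dicut Y|.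
Proof. exact: leq_trans (leq_addr _ _) (dicut_submod X Y). Qed.

Lemma dicut_outdegree X :
  #|dicut X| = \sum_(x in X) #|[set y | e x y && (y \notin X)]|.
Proof.
rewrite dicutE.
rewrite -(pair_big predT predT (fun x y => nat_of_bool [&& e x y, x \in X & y \notin X])) /=.
rewrite [RHS]big_mkcond; apply: eq_bigr => x _.
case: (x \in X); last by rewrite big1 // => y _; rewrite andbF.
by rewrite -sum1_card [RHS]big_mkcond; apply: eq_bigr => y _; rewrite inE; case: ifP.
Qed.

(** In a simple graph a vertex of [X] has at most [#|X|.-1] neighbours inside [X]; its other edges
    leave [X]. *)
Lemma degree_dicut (d : nat) X : (forall x, d <= degree e x) ->
  #|X| * d <= #|X| * #|X|.-1 + #|dicut X|.
Proof.
move=> dP; rewrite dicut_outdegree -!sum_nat_const -big_split /=.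
apply: leq_sum => x xX; apply: leq_trans (dP x) _.
rewrite (cardsD1 x X) xX /= add0n /degree.
apply: leq_trans (leq_card_setU _ _); apply: subset_leq_card.
apply/subsetP=> y; rewrite !inE => exy; rewrite exy /=.
by rewrite (_ : y != x) ?orbN //=; apply: contraTneq exy => ->; rewrite e_irr.
Qed.

End Cuts.

(** * Karger's contraction argument, with contractions encoded as vertex labellings *)

Lemma sum_card_swap (I J : finType) (A : {set I}) (B : {set J}) (q : I -> J -> bool) :
  \sum_(i in A) #|[set j in B | q i j]| = \sum_(j in B) #|[set i in A | q i j]|.
Proof.
under eq_bigr => i _ do rewrite -sum1_card.
under [RHS]eq_bigr => j _ do rewrite -sum1_card.
rewrite (exchange_big_dep [in B]) => [|i j _] /=; last by rewrite inE => /andP[].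
by apply: eq_bigr => j jB; apply: eq_bigl => i; rewrite !inE jB.
Qed.

Section Karger.
Variables (T U : finType) (e : rel T) (r : T) (lam : nat).
Hypotheses (e_sym : symmetric e) (lam_gt0 : 0 < lam).
Hypothesis lamP : forall X, is_cut X -> lam <= #|dicut e X|.

(** The fibres of [f] are the vertices of a contracted multigraph; compatible sets are the unions of
    fibres. *)
Definition compat (f : T -> U) (X : {set T}) :=
  [forall x, forall y, (f x == f y) ==> ((x \in X) == (y \in X))].

Lemma compatP f (X : {set T}) :
  reflect (forall x y, f x = f y -> (x \in X) = (y \in X)) (compat f X).
Proof.
apply: (iffP forallP) => [H x y fxy|H x].
  by have /forallP/(_ y) := H x; rewrite fxy eqxx => /eqP.
by apply/forallP=> y; apply/implyP => /eqP/H ->.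
Qed.

(** Requiring [r \notin X] selects one side of each cut and, with non-emptiness, makes [X] a cut. *)
Definition compat_cuts (f : T -> U) : {set {set T}} :=
  [set X | [&& X != set0, r \notin X, compat f X & #|dicut e X| == lam]].

Definition merge (f : T -> U) (p : T * T) : T -> U :=
  fun z => if f z == f p.2 then f p.1 else f z.

Definition uncontracted (f : T -> U) : {set T * T} :=
  [set p | e p.1 p.2 && (f p.1 != f p.2)].

Lemma merge_labels f p : f p.1 != f p.2 ->
  #|[set merge f p x | x : T]| = #|[set f x | x : T]|.-1.
Proof.
move=> fp; rewrite (cardsD1 (f p.2) [set f x | x : T]) imset_f //=.
apply: eq_card => a; rewrite !inE; apply/imsetP/andP.
  case=> z _ ->; rewrite /merge; case: (eqVneq (f z) (f p.2)) => E.
    by rewrite fp imset_f.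
  by rewrite E imset_f.
case=> ap /imsetP[z _ az]; exists z => //.
by rewrite /merge -az (negbTE ap).
Qed.

Lemma compat_merge f p (X : {set T}) : compat f X -> (p.1 \in X) = (p.2 \in X) ->
  compat (merge f p) X.
Proof.
move=> /compatP fX pX; apply/compatP=> x y; rewrite /merge.
case: eqP => [/fX ->|_]; case: eqP => [/fX ->|_] //.
- by move/fX <-.
- by move/fX ->.
- exact: fX.
Qed.

(** Sorting the surviving arcs by the label of their tail gives the arcs leaving each class, and a
    class is a cut once there are two classes. *)
Lemma uncontracted_ge f : 1 < #|[set f x | x : T]| ->
  #|[set f x | x : T]| * lam <= #|uncontracted f|.
Proof.
move=> N1; rewrite -sum_nat_const.
have -> : #|uncontracted f| =
    \sum_(a in [set f x | x : T]) #|dicut e [set x | f x == a]|.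
  rewrite -sum1_card (partition_big (fun p => f p.1) [in [set f x | x : T]]) /=;
    last by move=> p _; apply: imset_f.
  apply: eq_bigr => a _; rewrite -sum1_card; apply: eq_bigl => p; rewrite !inE.
  by case: (eqVneq (f p.1) a) => [<-|]; rewrite ?andbT ?andbF //= eq_sym.
apply: leq_sum => a /imsetP[x _ ->]; apply: lamP; apply/andP; split.
  by apply/set0Pn; exists x; rewrite inE.
rewrite properT; apply: contraL N1 => /eqP fa; rewrite -leqNgt.
rewrite (_ : [set f x | x : T] = [set f x]) ?cards1 //.
apply/setP=> b; rewrite inE; apply/imsetP/eqP => [[y _ ->]|->]; last by exists x.
by have: y \in [set: T] by []; rewrite -fa inE => /eqP.
Qed.

Lemma compat_cut_label f X : X \in compat_cuts f ->
  exists2 x, x \in X & f x != f r.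
Proof.
rewrite inE => /and4P[/set0Pn[x xX] rX /compatP fX _]; exists x => //.
by apply: contraNneq rX => /fX <-.
Qed.

(** With two classes, the one avoiding [r] is the only candidate. *)
Lemma compat_cuts_le1 f : #|[set f x | x : T]| = 2 -> #|compat_cuts f| <= 1.
Proof.
move=> N2; rewrite -(cards1 [set x | f x != f r]); apply: subset_leq_card.
apply/subsetP => X XM; have [x xX fx] := compat_cut_label XM.
move: XM; rewrite !inE => /and4P[_ rX /compatP fX _].
apply/eqP/setP => z; rewrite inE; case: (eqVneq (f z) (f r)) => [/fX ->|fz].
  exact: negbTE.
have /eqP E : f x |: [set f r] == [set f x | x : T].
  rewrite eqEcard N2 cards2 fx leqnn andbT.
  by apply/subsetP=> a /set2P[] ->; apply: imset_f.
have : f z \in [set f x | x : T] by apply: imset_f.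
by rewrite -E !inE (negbTE fz) orbF => /eqP/fX ->.
Qed.

(* Karger's contraction step, as a double counting: each minimum cut survives
   the contraction of all but a fraction 2/N of the uncontracted edges. *)
Lemma compat_cuts_bound f :
  #|compat_cuts f| * 2 <= #|[set f x | x : T]| * #|[set f x | x : T]|.-1.
Proof.
move: {2}#|_| (erefl #|[set f x | x : T]|) => N.
elim: N f => [|N IH] f fN.
  have: f r \in [set f x | x : T] by apply: imset_f.
  by rewrite (cards0_eq fN) in_set0.
case: N => [|[|N]] in fN IH *.
- rewrite (_ : compat_cuts f = set0) ?cards0 //.
  apply/setP=> X; rewrite in_set0; apply/negP => /compat_cut_label[x _].
  have /eqP/cards1P[a fa] := fN.
  have fE z : f z = a by apply/set1P; rewrite -fa; apply: imset_f.
  by rewrite !fE eqxx.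
- by rewrite fN /= muln1 (leq_mul (compat_cuts_le1 fN) (leqnn 2)).
set M := compat_cuts f; set W := uncontracted f.
have W1 : N.+3 * lam <= #|W| by rewrite -fN uncontracted_ge ?fN.
(* Count pairs of a cut and a surviving arc not crossing it: for a fixed arc these cuts survive its
   contraction, which leaves [N.+2] labels. *)
have count1 : \sum_(X in M) #|[set p in W | (p.1 \in X) == (p.2 \in X)]| * 2
    <= \sum_(p in W) (N.+2 * N.+1).
  rewrite -big_distrl /=.
  rewrite sum_card_swap.
  rewrite big_distrl /=; apply: leq_sum => p pW.
  have fp : f p.1 != f p.2 by move: pW; rewrite inE => /andP[].
  have := IH (merge f p); rewrite merge_labels // fN => /(_ erefl) /=.
  apply: leq_trans; rewrite leq_pmul2r //; apply: subset_leq_card.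
  apply/subsetP => X; rewrite !inE => /andP[/and4P[-> -> fX ->] /eqP pX].
  by rewrite compat_merge.
(* Each crossing edge contributes two opposite arcs, hence [lam * 2]. *)
have count2 X : X \in M ->
    #|W| <= #|[set p in W | (p.1 \in X) == (p.2 \in X)]| + lam * 2.
  rewrite inE => /and4P[_ _ _ /eqP dX].
  have dX' := dicutC e_sym X; rewrite dX in dX'.
  rewrite muln2 -addnn -{1}dX -dX'.
  apply: leq_trans (leq_trans (leq_card_setU _ _) (leq_add (leqnn _) (leq_card_setU _ _))).
  apply: subset_leq_card; apply/subsetP=> p pW; rewrite !inE in pW *.
  case/andP: pW => -> -> /=.
  by case: (p.1 \in X); case: (p.2 \in X).
rewrite fN /=.
have count3 : #|M| * (#|W| - lam * 2) * 2 <= #|W| * (N.+2 * N.+1).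
  rewrite -mulnA -[#|M| * _]sum_nat_const -[#|W| * _]sum_nat_const; apply: leq_trans count1.
  by apply: leq_sum => X /count2 ?; rewrite leq_pmul2r // leq_subLR addnC.
have W0 : 0 < #|W| by apply: leq_trans W1; rewrite muln_gt0 lam_gt0.
(* As [#|W|] is at least [N.+3 * lam], a cut is crossed by at most a fraction 2/(N+3) of the
   arcs. *)
have H : N.+1 * #|W| <= N.+3 * (#|W| - lam * 2).
  by rewrite mulnBr mulnA; lia.
rewrite -(leq_pmul2l (isT : 0 < N.+1)) -(leq_pmul2l W0).
apply: leq_trans (_ : N.+3 * (#|M| * (#|W| - lam * 2) * 2) <= _).
  have := leq_mul (leqnn (#|M| * 2)) H.
  by congr (_ <= _); ring.
have := leq_mul (leqnn N.+3) count3.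
by congr (_ <= _); ring.
Qed.

End Karger.

(** * Crossing sets and laminar families *)

Section SetFamilies.
Variable T : finType.
Implicit Types (X Y Z W : {set T}) (F L K : {set {set T}}).

(** All four corners are non-empty. The last conjunct, for the corner outside both sets, makes the
    relation invariant under complements. *)
Definition crosses X Y : bool :=
  [&& X :&: Y != set0, X :\: Y != set0, Y :\: X != set0 & X :|: Y != setT].

Lemma crossesC X Y : crosses X Y = crosses Y X.
Proof. by rewrite /crosses setIC setUC; congr andb; rewrite andbCA. Qed.

Lemma crosses_setC X Y : crosses (~: X) Y = crosses X Y.
Proof.
rewrite /crosses.
have -> : ~: X :&: Y = Y :\: X by rewrite setDE setIC.
have -> : ~: X :\: Y = ~: (X :|: Y) by rewrite setCU setDE.
have -> : Y :\: ~: X = X :&: Y by rewrite setDE setCK setIC.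
have -> : (~: X :|: Y != setT) = (X :\: Y != set0).
  by rewrite -(inj_eq (@setC_inj T)) setCT setCU setCK setDE.
rewrite -(inj_eq (@setC_inj T) (~: _)) setCK setC0.
by case: (_ != _); case: (_ != _); case: (_ != _); rewrite ?andbF ?andbT.
Qed.

(** The points [a] and [b] fill two corners for both [X] and [Z]. A point outside [X :|: Z] fills a
    third for both, and [c] or [c'] fills the fourth for one of them. *)
Lemma crosses_setI X Z Y :
  crosses X Z -> crosses (X :&: Z) Y -> crosses X Y || crosses Z Y.
Proof.
case/and4P=> _ _ _ /eqP XZ /and4P[].
case/set0Pn=> a; rewrite !inE => /andP[/andP[aX aZ] aY].
case/set0Pn=> b; rewrite !inE => /and3P[bY bX bZ].
case/set0Pn=> c; rewrite !inE => /andP[cXZ cY] XZY.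
have [c' c'Y] : exists z, z \notin (X :&: Z) :|: Y.
  by apply/existsP; rewrite -negb_forall; apply: contra XZY => /forallP H;
    apply/eqP/setP=> z; rewrite H inE.
have [c'' c''XZ] : exists z, z \notin X :|: Z.
  apply/existsP; rewrite -negb_forall; apply/negP => /forallP H.
  by apply: XZ; apply/setP=> z; rewrite H inE.
have XY0 : X :&: Y != set0 by apply/set0Pn; exists a; rewrite inE aX.
have ZY0 : Z :&: Y != set0 by apply/set0Pn; exists a; rewrite inE aZ.
have XY1 : X :\: Y != set0 by apply/set0Pn; exists b; rewrite !inE bX bY.
have ZY1 : Z :\: Y != set0 by apply/set0Pn; exists b; rewrite !inE bZ bY.
rewrite /crosses XY0 ZY0 XY1 ZY1 /=.
have D (A : {set T}) z : z \in Y -> z \notin A -> Y :\: A != set0.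
  by move=> zY zA; apply/set0Pn; exists z; rewrite !inE zA zY.
have E (A : {set T}) z : z \notin Y -> z \notin A -> A :|: Y != setT.
  move=> zY zA; apply: contraTneq isT => /setP/(_ z).
  by rewrite !inE (negbTE zY) (negbTE zA).
move: cXZ c'Y c''XZ; rewrite !inE !negb_and !negb_or => cXZ /andP[c'XZ c'Y] /andP[dX dZ].
rewrite negb_and in c'XZ.
case: (boolP (c'' \in Y)) => dY.
  rewrite (D _ _ dY dX) (D _ _ dY dZ) /=.
  by case/orP: c'XZ => /(E _ _ c'Y) ->; rewrite ?orbT.
rewrite (E _ _ dY dX) (E _ _ dY dZ) !andbT.
by case/orP: cXZ => /(D _ _ cY) ->; rewrite ?orbT.
Qed.

Definition laminar L : Prop := forall X Y, X \in L -> Y \in L ->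
  [\/ X \subset Y, Y \subset X | [disjoint X & Y]].

Lemma laminar_sub L K : K \subset L -> laminar L -> laminar K.
Proof. by move=> /subsetP KL lamL X Y /KL XL /KL YL; apply: lamL. Qed.

Lemma cover_sub L K : K \subset L -> cover K \subset cover L.
Proof.
by move=> /subsetP KL; apply/bigcupsP=> X /KL XL; apply: bigcup_sup XL.
Qed.

(** Take a member [X] of maximal size: the members not inside it are disjoint from it, and if there
    are none it is the whole cover. *)
Lemma laminar_split L : laminar L -> L != set0 ->
  cover L \in L \/ exists L1 L2,
    [/\ L1 != set0, L2 != set0, L1 :|: L2 = L, [disjoint L1 & L2]
      & [disjoint cover L1 & cover L2]].
Proof.
move=> lamL /set0Pn[X0 X0L].
pose X := [arg max_(X > X0 in L) #|X|]; rewrite -/X.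
have [XL Xmax] : X \in L /\ forall Y, Y \in L -> #|Y| <= #|X|.
  by rewrite /X; case: arg_maxnP.
pose L1 := [set Y in L | Y \subset X]; pose L2 := [set Y in L | ~~ (Y \subset X)].
have L12 : L1 :|: L2 = L.
  by apply/setP=> Y; rewrite !inE -andb_orr orbN andbT.
have [L20|L20] := eqVneq L2 set0.
  left; rewrite (_ : cover L = X) //; apply/eqP; rewrite eqEsubset.
  rewrite (bigcup_sup X) // andbT; apply/bigcupsP=> Y YL; apply/negPn/negP=> YX.
  by have: Y \in L2; [rewrite inE YL YX | rewrite L20 inE].
right; exists L1, L2; split=> //.
- by apply/set0Pn; exists X; rewrite inE XL subxx.
- by rewrite disjoints_subset; apply/subsetP=> Y; rewrite !inE => /andP[-> ->].
have cov1 : cover L1 \subset X by apply/bigcupsP=> Y; rewrite inE => /andP[].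
apply: disjointWl cov1 _; apply/pred0P=> z /=; apply/negP=> /andP[zX /bigcupP[Y]].
rewrite inE => /andP[YL YX] zY; case: (lamL X Y XL YL) => [XY||dis].
- by move: YX; rewrite (_ : Y = X) ?subxx //; apply/esym/eqP; rewrite eqEcard XY Xmax.
- by rewrite (negbTE YX).
- by rewrite (disjointFr dis zX) in zY.
Qed.

(* The summand 3 makes the bound improve when the family splits into two parts
   with disjoint covers; it pays for the at most three sets that have to be
   removed from the top before such a split or a gap of d / 2 appears. *)
Lemma laminar_card L (d : nat) :
  laminar L -> L != set0 -> (forall X, X \in L -> d <= #|X|) ->
  (forall X Y Z W, X \in L -> Y \in L -> Z \in L -> W \in L ->
     W \proper Z -> Z \proper Y -> Y \proper X -> d <= #|X :\: W| * 2) ->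
  d * (#|L| + 3) <= 6 * #|cover L|.
Proof.
have [n] := ubnP #|L|; elim: n L => // n IH L Ln lamL L0 dL gap.
have sub K : K \subset L -> #|K| < n -> K != set0 -> d * (#|K| + 3) <= 6 * #|cover K|.
  move=> KL Kn K0; have sKL := subsetP KL; apply: IH => //.
  - exact: laminar_sub lamL.
  - by move=> X /sKL; apply: dL.
  - by move=> X Y Z W /sKL XL /sKL YL /sKL ZL /sKL; apply: gap.
(* Both parts are non-empty and smaller than [L], so induction gives a summand 3 for each: hence the
   6. *)
have split K : K \subset L -> K != set0 ->
    cover K \in K \/ d * (#|K| + 6) <= 6 * #|cover L|.
  move=> KL K0.
  have [|[L1 [L2 [L10 L20 defK dis12 cov12]]]] := laminar_split (laminar_sub KL lamL) K0.
    by left.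
  right.
  have cardK : #|K| = #|L1| + #|L2|.
    by rewrite -defK cardsU (disjoint_setI0 dis12) cards0 subn0.
  have KLc := subset_leq_card KL.
  have := L10; rewrite -card_gt0 => L1c; have := L20; rewrite -card_gt0 => L2c.
  have L1L : L1 \subset L by rewrite (subset_trans _ KL) // -defK subsetUl.
  have L2L : L2 \subset L by rewrite (subset_trans _ KL) // -defK subsetUr.
  have b1 : d * (#|L1| + 3) <= 6 * #|cover L1| by apply: sub => //; lia.
  have b2 : d * (#|L2| + 3) <= 6 * #|cover L2| by apply: sub => //; lia.
  have covle : #|cover L1| + #|cover L2| <= #|cover L|.
    rewrite -cardsUI (disjoint_setI0 cov12) cards0 addn0 subset_leq_card //.
    by rewrite subUset !cover_sub.
  apply: leq_trans (leq_mul (leqnn 6) covle).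
  rewrite [6 * _]mulnDr; apply: leq_trans (leq_add b1 b2).
  by rewrite -mulnDr cardK addnACA.
have weaken m : #|L| + 3 <= m -> d * m <= 6 * #|cover L| ->
    d * (#|L| + 3) <= 6 * #|cover L|.
  by move=> Lm H; apply: leq_trans (leq_mul (leqnn d) Lm) H.
have [L3|L4] := leqP #|L| 3.
  have [X XL] := set0Pn _ L0.
  apply: (weaken 6); first by lia.
  have dX := dL X XL; have XC : #|X| <= #|cover L| by apply/subset_leq_card/bigcup_sup.
  by lia.
have remove K : #|K| > 1 -> K :\ cover K != set0.
  by rewrite -card_gt0 (cardsD1 (cover K)); case: (_ \in _) => // /ltnW.
have properD K : cover (K :\ cover K) \in K :\ cover K ->
    cover (K :\ cover K) \proper cover K.
  by rewrite properEneq !inE => /andP[-> _]; apply: cover_sub; apply: subsetDl.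
have DL K : K \subset L -> K :\ cover K \subset L.
  by move=> KL; apply: subset_trans (subsetDl _ _) KL.
(* Peel off the largest member three times; whenever the rest splits, the slack 6 absorbs the
   members removed so far. *)
have [XL|] := split L (subxx _) L0; last by apply: weaken; lia.
pose K1 := L :\ cover L.
have K1L : K1 \subset L by apply: DL.
have c1 : #|L| = #|K1|.+1 by rewrite (cardsD1 (cover L)) XL.
have [|YK|] := split K1 K1L; [by apply: remove; lia| |by apply: weaken; lia].
pose K2 := K1 :\ cover K1.
have K2L : K2 \subset L by apply: DL.
have c2 : #|K1| = #|K2|.+1 by rewrite (cardsD1 (cover K1)) YK.
have [|ZK|] := split K2 K2L; [by apply: remove; lia| |by apply: weaken; lia].
pose K3 := K2 :\ cover K2.
have K3L : K3 \subset L by apply: DL.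
have c3 : #|K2| = #|K3|.+1 by rewrite (cardsD1 (cover K2)) ZK.
have K30 : K3 != set0 by apply: remove; lia.
have [|WK|] := split K3 K3L; [exact: K30| |by apply: weaken; lia].
have b3 : d * (#|K3| + 3) <= 6 * #|cover K3| by apply: sub => //; lia.
(* The gap has at least [d / 2] elements; six times that pays the [3 * d] owed for the three removed
   members. *)
have g : d <= #|cover L :\: cover K3| * 2.
  apply: (gap _ (cover K1) (cover K2)) => //; try exact: properD.
  - exact: (subsetP K1L).
  - exact: (subsetP K2L).
  - exact: (subsetP K3L).
have := cardsID (cover K3) (cover L).
rewrite (setIidPr (cover_sub K3L)) => <-.
rewrite mulnDr; lia.
Qed.

(** For laminar [L] this is the smallest member containing [x], or [setT] if there is none; the
    latter accounts for the one extra label in the count below. *)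
Definition laminar_label L (x : T) : {set T} := \bigcap_(X in L | x \in X) X.

Lemma laminar_labelP L x y X : laminar_label L x = laminar_label L y -> X \in L ->
  (x \in X) = (y \in X).
Proof.
have imp a b : laminar_label L a = laminar_label L b -> X \in L -> a \in X -> b \in X.
  move=> ab XL aX; have: b \in laminar_label L b by apply/bigcapP=> Y /andP[].
  by rewrite -ab => /bigcapP; apply; rewrite XL.
by move=> xy XL; apply/idP/idP; apply: imp.
Qed.

Lemma laminar_label_card L : laminar L -> #|[set laminar_label L x | x : T]| <= #|L|.+1.
Proof.
move=> lamL; apply: leq_trans (_ : #|setT |: L| <= _); last first.
  by rewrite cardsU1; case: (_ \notin _).
apply: subset_leq_card; apply/subsetP=> A /imsetP[x _ ->].
have [/existsP[X0 /andP[X0L xX0]]|/existsPn none] :=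
    boolP [exists X, (X \in L) && (x \in X)]; last first.
  by rewrite /laminar_label big_pred0 ?inE ?eqxx // => X; apply/negbTE/none.
case: (@arg_minnP _ X0 [pred X | (X \in L) && (x \in X)] (fun X => #|X|)) => /=.
  by rewrite X0L.
move=> X /andP[XL xX] Xmin; rewrite inE; apply/orP; right.
rewrite (_ : laminar_label L x = X) //; apply/eqP; rewrite eqEsubset.
rewrite (bigcap_inf X) ?XL //=; apply/bigcapsP=> Y /andP[YL xY].
have [//|YX|dis] := lamL X Y XL YL.
  by rewrite (_ : Y = X) //; apply/eqP; rewrite eqEcard YX Xmin // YL.
by have := disjointFr dis xX; rewrite xY.
Qed.

End SetFamilies.

(** * Minimum cuts of simple graphs: sizes, uncrossing and the labelling *)

Section MinCuts.
Variables (T : finType) (e : rel T) (d lam : nat).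
Hypotheses (e_sym : symmetric e) (e_irr : irreflexive e).
Hypothesis lamP : forall X : {set T}, is_cut X -> lam <= #|dicut e X|.
Hypotheses (dP : forall x, d <= degree e x) (lam_le : lam <= d).
Implicit Types (X Y Z W : {set T}) (F L : {set {set T}}).

Definition mincut X := is_cut X && (#|dicut e X| == lam).
Definition ntcut X := mincut X && ~~ trivial_cut X.

Lemma is_cutC X : is_cut (~: X) = is_cut X.
Proof.
rewrite /is_cut !properT -(inj_eq (@setC_inj T)) setCK setC0 andbC; congr andb.
by rewrite -(inj_eq (@setC_inj T)) setCK setCT.
Qed.

Lemma mincutC X : mincut (~: X) = mincut X.
Proof. by rewrite /mincut is_cutC dicutC. Qed.

Lemma trivial_cutC X : trivial_cut (~: X) = trivial_cut X.
Proof. by rewrite /trivial_cut setCK orbC. Qed.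

Lemma ntcutC X : ntcut (~: X) = ntcut X.
Proof. by rewrite /ntcut mincutC trivial_cutC. Qed.

(** With [#|X| = m + 1], the degree count and [lam <= d] give [m * d <= (m + 1) * m]; cancel
    [m > 0]. *)
Lemma mincut_card X : mincut X -> #|X| != 1 -> d <= #|X|.
Proof.
move=> /andP[/andP[X0 _] /eqP dX] X1; rewrite -card_gt0 in X0.
have := degree_dicut e_irr X dP; rewrite dX => H.
rewrite -(@leq_pmul2l #|X|.-1); last by lia.
case: #|X| X0 X1 H => // m _ m0 /=; rewrite mulSn addnC => H.
have {}H : m * d <= m.+1 * m by lia.
by rewrite [m * m.+1]mulnC.
Qed.

Lemma ntcut_card X : ntcut X -> d <= #|X|.
Proof.
by case/andP=> mX; rewrite /trivial_cut negb_or => /andP[X1 _]; apply: mincut_card.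
Qed.

Lemma ntcutN_card X : ntcut X -> d <= #|~: X|.
Proof. by rewrite -ntcutC; apply: ntcut_card. Qed.

(** At most [2 * d] arcs leave [D = X :\: W], so the degree count gives
    [(#|D| - 2) * d <= #|D| * (#|D| - 1)], which fails if [#|D| * 2 < d]. *)
Lemma mincut_gap X W : mincut X -> mincut W -> W \subset X -> 2 < #|X :\: W| ->
  d <= #|X :\: W| * 2.
Proof.
move=> /andP[_ /eqP dX] /andP[_ /eqP dW] WX; set D := X :\: W => D3.
have degD := degree_dicut e_irr D dP.
have dD : #|dicut e D| <= 2 * d.
  rewrite /D setDE; apply: leq_trans (dicut_setI _ _ _) _.
  by rewrite (dicutC e_sym) dX dW; lia.
rewrite leqNgt; apply/negP=> small.
case: #|D| D3 small degD => [|[|[|k]]] //= _ small degD.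
have := leq_mul (leqnn k.+1) small.
have: k.+1 * d <= k.+3 * k.+2.
  rewrite -(leq_add2r (2 * d)) -mulnDl addn2.
  by apply: leq_trans degD _; rewrite leq_add2l.
move=> H1 H2; have := leq_trans H2 H1; apply/negP.
rewrite -ltnNge [k.+1 * _]mulnS [k.+1 * _]mulnCA addSn ltnS.
by apply: leq_trans (leq_addl k _); rewrite leq_mul2l; lia.
Qed.

(** Both [X :&: Z] and [X :|: Z] are cuts, hence of size at least [lam], and submodularity bounds
    their total by [2 * lam]. *)
Lemma mincut_setI X Z : mincut X -> mincut Z -> crosses X Z -> mincut (X :&: Z).
Proof.
move=> /andP[_ /eqP dX] /andP[_ /eqP dZ] /and4P[XZ0 XDZ ZDX XZ1].
have cI : is_cut (X :&: Z).
  rewrite /is_cut XZ0 properT; apply: contraNneq XDZ => XZ.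
  by rewrite setDE -[X :&: ~: Z](_ : set0 = _) //; apply/esym/setP=> z;
    have /setP/(_ z) := XZ; rewrite !inE => /andP[_ ->]; rewrite andbF.
have cU : is_cut (X :|: Z).
  rewrite /is_cut properT XZ1 andbT; apply: contraNneq XZ0 => XZ.
  by rewrite -subset0 -XZ (subset_trans (subsetIl _ _)) ?subsetUl.
rewrite /mincut cI eqn_leq lamP // andbT.
have := dicut_submod e X Z; rewrite dX dZ; have := lamP cU; lia.
Qed.

(** Boolean-valued, so that [maxset] can supply a maximal such family. *)
Definition crossfree F :=
  [forall X in F, ntcut X] && [forall X in F, forall Y in F, ~~ crosses X Y].

Lemma crossfreeP F :
  reflect [/\ forall X, X \in F -> ntcut X
    & forall X Y, X \in F -> Y \in F -> ~~ crosses X Y] (crossfree F).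
Proof.
apply: (iffP andP) => [[/forall_inP ntF /forall_inP cF]|[ntF cF]].
  by split=> // X Y /cF /forall_inP; apply.
by split; apply/forall_inP=> // X XF; apply/forall_inP=> Y YF; apply: cF.
Qed.

Lemma crosses_irr X : ~~ crosses X X.
Proof. by rewrite /crosses setDv eqxx andbF. Qed.

Lemma max_crossfree_mem F Z : maxset crossfree F -> ntcut Z ->
  (forall X, X \in F -> ~~ crosses X Z) -> Z \in F.
Proof.
case/maxsetP=> /crossfreeP[ntF cF] Fmax ntZ cZ.
rewrite -(Fmax (Z |: F)) ?setU11 ?subsetUr //.
apply/crossfreeP; split=> [X|X Y] /setU1P[->|XF] //; first exact: ntF.
  by move=> /setU1P[->|YF]; rewrite ?crosses_irr // crossesC cZ.
by move=> /setU1P[->|YF]; [apply: cZ | apply: cF].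
Qed.

Lemma max_crossfreeC F X : maxset crossfree F -> X \in F -> ~: X \in F.
Proof.
move=> Fmax XF; have [/crossfreeP[ntF cF] _] := maxsetP Fmax.
apply: (max_crossfree_mem Fmax); first by rewrite ntcutC ntF.
by move=> Y YF; rewrite crossesC crosses_setC crossesC cF.
Qed.

(* Uncrossing: if [Z] separates [u] from [v] and crosses [X], then on the side
   [A] of [X] containing both, the two halves [A :&: Z] and [A :\: Z] are
   minimum cuts separating [u] from [v], and they cannot both be singletons. *)
Lemma max_crossfree_sep F Z (u v : T) : 2 < d -> maxset crossfree F -> ntcut Z ->
  (u \in Z) != (v \in Z) -> exists2 X, X \in F & (u \in X) != (v \in X).
Proof.
move=> d3 Fmax; have [/crossfreeP[ntF cF] _] := maxsetP Fmax.
(* Induction on the number of members of [F] that cross [Z]. *)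
have [n] := ubnP #|[set Y in F | crosses Z Y]|; elim: n Z => // n IH Z Zn ntZ uvZ.
have [/existsP[X /andP[XF XZ]]|/existsPn none] :=
    boolP [exists X, (X \in F) && crosses X Z]; last first.
  by exists Z => //; apply: (max_crossfree_mem Fmax) => // X XF;
    have := none X; rewrite XF.
have [uvX|] := boolP ((u \in X) != (v \in X)); first by exists X.
rewrite negbK => /eqP uvX.
pose A := if u \in X then X else ~: X.
have [AF uA vA AZ] : [/\ A \in F, u \in A, v \in A & crosses A Z].
  rewrite /A; case: ifP => uX; first by rewrite -uvX.
  by rewrite !inE -uvX uX crosses_setC (max_crossfreeC Fmax).
have step Z' : ntcut Z' -> (u \in Z') != (v \in Z') -> crosses A Z' ->
    ntcut (A :&: Z') -> #|[set Y in F | crosses Z' Y]| < n.+1 ->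
    exists2 X, X \in F & (u \in X) != (v \in X).
  move=> ntZ' uvZ' AZ' nt Zn'; apply: (IH (A :&: Z')) => //; last first.
    by rewrite !inE uA vA.
  (* A member crossing [A :&: Z'] crosses [Z'], since it cannot cross [A]; and [A] crosses [Z'] but
     not [A :&: Z']. *)
  apply: leq_trans (_ : #|[set Y in F | crosses Z' Y]| <= n) => //.
  apply/proper_card/properP; split.
    apply/subsetP=> Y; rewrite !inE => /andP[YF c]; rewrite YF /=.
    by have := crosses_setI AZ' c; rewrite (negbTE (cF _ _ AF YF)).
  exists A; rewrite !inE AF /= 1?crossesC //.
  by rewrite /crosses [_ :\: A](_ : _ = set0) ?eqxx ?andbF //; apply/eqP; rewrite setD_eq0 subsetIl.
have ntA := ntF A AF; have [mA _] := andP ntA; have [mZ _] := andP ntZ.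
have big Z' : mincut Z' -> crosses A Z' -> #|A :&: Z'| != 1 -> ntcut (A :&: Z').
  move=> mZ' AZ' c1; rewrite /ntcut mincut_setI //= /trivial_cut negb_or c1 /=.
  have := ntcutN_card ntA.
  have le : #|~: A| <= #|~: (A :&: Z')| by rewrite subset_leq_card // setCS subsetIl.
  move=> dA; rewrite neq_ltn; apply/orP; right.
  exact: leq_trans (leq_trans (ltnW d3) dA) le.
have AZC : crosses A (~: Z) by rewrite crossesC crosses_setC crossesC.
have := ntcut_card ntA; rewrite -(cardsID Z A) setDE => cA.
have [c1|c1] := eqVneq #|A :&: Z| 1; last by apply: (step Z) => //; apply: big.
(* Now [A :&: Z] is a singleton, so [A :\: Z] is not one, as [#|A| >= d > 2]. *)
apply: (step (~: Z)); rewrite ?ntcutC //.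
- by rewrite !inE (inj_eq negb_inj).
- apply: big; rewrite ?mincutC //.
  apply: contraTneq d3 => c2; rewrite -leqNgt.
  by rewrite c1 c2 in cA.
- by rewrite (eq_card (B := [set Y in F | crosses Z Y])) // => Y; rewrite !inE crosses_setC.
Qed.

(** The members avoiding [r] of a maximal cross-free family are laminar, since [r] lies outside all
    their unions, and they still separate whatever the family separates. The first alternative
    covers the case of no members. *)
Lemma laminar_labelling (r : T) : 2 < d -> exists f : T -> {set T},
  (forall Z, ntcut Z -> compat f Z) /\
  (#|[set f x | x : T]| <= 1 \/ d * #|[set f x | x : T]| <= 6 * #|T|).
Proof.
move=> d3.
have [F Fmax _] : {F | maxset crossfree F & set0 \subset F}.
  by apply: maxset_exists; apply/crossfreeP; split=> [X|X Y]; rewrite inE.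
have [/crossfreeP[ntF cF] _] := maxsetP Fmax.
pose L := [set X in F | r \notin X].
have LF X : X \in L -> X \in F by rewrite inE => /andP[].
have lamL : laminar L.
  move=> X Y; rewrite !inE => /andP[XF rX] /andP[YF rY].
  have := cF X Y XF YF; rewrite /crosses !negb_and !negbK.
  case/or4P.
  - by rewrite setI_eq0; constructor 3.
  - by rewrite setD_eq0; constructor 1.
  - by rewrite setD_eq0; constructor 2.
  - by move/eqP/setP/(_ r); rewrite !inE (negbTE rX) (negbTE rY).
exists (laminar_label L); split=> [Z ntZ|].
  apply/compatP=> u v uv; apply/eqP; apply/negPn/negP=> uvZ.
  have [X XF /negP[]] := max_crossfree_sep d3 Fmax ntZ uvZ.
  have [rX|rX] := boolP (r \in X).
    have XL : ~: X \in L by rewrite inE (max_crossfreeC Fmax) // inE rX.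
    by have := laminar_labelP uv XL; rewrite !inE => /negb_inj ->.
  by apply/eqP/(laminar_labelP uv); rewrite inE XF rX.
have cardL := laminar_label_card lamL.
have [L0|L0] := eqVneq L set0; first by left; rewrite L0 cards0 in cardL *.
right.
have mL X : X \in L -> mincut X by move=> /LF/ntF/andP[].
have big X : X \in L -> d <= #|X| by move=> /LF/ntF/ntcut_card.
have gap X Y Z W : X \in L -> Y \in L -> Z \in L -> W \in L ->
    W \proper Z -> Z \proper Y -> Y \proper X -> d <= #|X :\: W| * 2.
  move=> /mL mX _ _ /mL mW WZ ZY YX.
  have WX : W \subset X.
    exact: subset_trans (proper_sub WZ) (subset_trans (proper_sub ZY) (proper_sub YX)).
  (* Three strict inclusions leave at least three elements in [X :\: W]. *)
  apply: mincut_gap => //; rewrite cardsDS // ltn_subRL.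
  have c1 := proper_card WZ; have c2 := proper_card ZY; have c3 := proper_card YX.
  by rewrite addn2; apply: leq_ltn_trans c3; apply: leq_ltn_trans c2.
have H := laminar_card lamL L0 big gap.
apply: leq_trans (_ : d * (#|L| + 3) <= _).
  by rewrite leq_mul // (leq_trans cardL) // -addn1 leq_add.
by apply: leq_trans H _; rewrite leq_mul // max_card.
Qed.

End MinCuts.

(** * Counting the minimum cuts of a connected simple graph *)

Section Counting.
Variables (T : finType) (e : rel T).
Hypotheses (e_simple : simple_graph e) (e_conn : connected_graph e) (T2 : 2 <= #|T|).
Let e_sym : symmetric e. Proof. by case: e_simple. Qed.
Let e_irr : irreflexive e. Proof. by case: e_simple. Qed.

Lemma min_degree_le x : min_degree e <= degree e x.
Proof.
rewrite /min_degree; have := mem_index_enum x.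
elim: (index_enum T) => // y s IH; rewrite inE big_cons geq_min.
by case/predU1P=> [->|/IH ->]; rewrite ?leqnn ?orbT.
Qed.

Lemma unorientedC (X : {set T}) : unoriented (~: X) = unoriented X.
Proof. by rewrite /unoriented setCK setUC. Qed.

Lemma is_cut1 (x : T) : is_cut [set x].
Proof.
rewrite /is_cut -card_gt0 cards1 properT /=; apply: contraTneq T2 => xT.
by rewrite -cardsT -xT cards1.
Qed.

Lemma cut_size1 x : #|dicut e [set x]| = degree e x.
Proof.
rewrite dicut_outdegree big_set1; apply: eq_card => y; rewrite !inE.
by case: (eqVneq y x) => [->|]; rewrite ?e_irr ?andbT.
Qed.

(** A non-empty set left by no arc is closed under adjacency, so by connectedness it contains every
    vertex. *)
Lemma dicut_gt0 (X : {set T}) : is_cut X -> 0 < #|dicut e X|.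
Proof.
case/andP=> /set0Pn[x xX]; rewrite properT => XT.
have [y yX] : exists y, y \notin X.
  apply/existsP; rewrite -negb_forall; apply: contra XT => /forallP H.
  by apply/eqP/setP=> z; rewrite H inE.
rewrite card_gt0; apply: contraNneq yX => X0.
have cl : closed e X.
  apply: (intro_closed (sym_connect_sym e_sym)) => a b eab aX; apply: contraT => bX.
  by have: (a, b) \in dicut e X; [rewrite inE eab aX | rewrite X0 inE].
by rewrite -(closed_connect cl (e_conn x y)).
Qed.

Lemma min_cut_value : exists lam, [/\ 0 < lam, lam <= min_degree e,
  forall X : {set T}, is_cut X -> lam <= #|dicut e X|
  & forall X : {set T}, is_min_cut e X = mincut e lam X].
Proof.
have [r _] : exists x : T, x \in T by apply/card_gt0P; apply: ltnW.
pose X0 := [arg min_(X < [set r] | is_cut X) cut_size e X].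
have [cX0 X0min] : is_cut X0 /\ forall X, is_cut X -> cut_size e X0 <= cut_size e X.
  by rewrite /X0; case: arg_minnP => //; apply: is_cut1.
have lamP X : is_cut X -> cut_size e X0 <= #|dicut e X|.
  by rewrite -cut_size_dicut //; apply: X0min.
have lam_deg x : cut_size e X0 <= degree e x by rewrite -cut_size1 lamP ?is_cut1.
exists (cut_size e X0); split=> //.
- by rewrite cut_size_dicut // dicut_gt0.
(* The default value [#|T|] of the minimum must be bounded below too; the degree of [r] does
   this. *)
- rewrite /min_degree; elim/big_ind: _ => // [|a b ? ?]; last by rewrite leq_min; apply/andP.
  by apply: leq_trans (lam_deg r) (max_card _).
move=> X; rewrite /is_min_cut /mincut; have [cX|//] := boolP (is_cut X).
rewrite -cut_size_dicut //; apply/forall_inP/eqP=> /= [Xmin|-> //].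
by apply/eqP; rewrite eqn_leq X0min // Xmin.
Qed.

Lemma nontrivial_min_cuts_le (U : finType) (r : T) (lam : nat) (f : T -> U) :
  (forall X, is_min_cut e X = mincut e lam X) ->
  (forall Z, ntcut e lam Z -> compat f Z) ->
  #|nontrivial_min_cuts e| <= #|compat_cuts e r lam f|.
Proof.
move=> minE fP.
apply: leq_trans (leq_imset_card (@unoriented T) [in compat_cuts e r lam f]).
apply: subset_leq_card.
apply/subsetP=> Q /imsetP[X]; rewrite inE minE => ntX ->{Q}.
wlog rX : X ntX / r \notin X => [hw|].
  have [rX|] := boolP (r \in X); last exact: hw.
  by rewrite -unorientedC; apply: hw; rewrite ?inE ?rX // [_ && _](@ntcutC T e).
apply: imset_f; rewrite inE rX (fP X ntX) /=.
by case/andP: ntX => /andP[/andP[-> _] ->].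
Qed.

Lemma min_cuts_le : #|min_cuts e| <= #|T| + #|nontrivial_min_cuts e|.
Proof.
apply: leq_trans (_ : #|[set unoriented [set x] | x : T] :|: nontrivial_min_cuts e| <= _).
  apply: subset_leq_card; apply/subsetP=> Q /imsetP[X]; rewrite inE => mX ->{Q}.
  rewrite inE; have [|tX] := boolP (trivial_cut X); last first.
    by apply/orP; right; apply: imset_f; rewrite inE mX.
  case/orP=> /cards1P[x xX]; apply/orP; left; apply/imsetP; exists x => //.
    by rewrite xX.
  by rewrite -unorientedC xX.
apply: leq_trans (leq_card_setU _ _) _.
by rewrite leq_add2r leq_imset_card.
Qed.

Lemma nontrivial_min_cuts_bound :
  0 < min_degree e /\
  #|nontrivial_min_cuts e| * min_degree e ^ 2 <= 18 * #|T| ^ 2.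
Proof.
have [r _] : exists x : T, x \in T by apply/card_gt0P; apply: ltnW.
have [lam [lam0 lam_le lamP minE]] := min_cut_value.
split; first exact: leq_trans lam0 lam_le.
set c := #|_|; set d := min_degree e; set n := #|T|.
have [d3|d2] := ltnP 2 d.
  have [f [fP fN]] := laminar_labelling e_sym e_irr lamP min_degree_le lam_le r d3.
  have := leq_mul (nontrivial_min_cuts_le r minE fP) (leqnn 2).
  move/leq_trans/(_ (compat_cuts_bound r e_sym lam0 lamP f)).
  rewrite -/c; set N := #|[set f x | x : T]| in fN *.
  case: fN => [N1|dN cN].
    have -> : N * N.-1 = 0 by case: N N1 => [|[]].
    by rewrite leqn0 muln_eq0 orbF => /eqP ->.
  have {}cN : c * 2 <= N * N by apply: leq_trans cN _; rewrite leq_mul2l leq_pred orbT.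
  (* From [c * 2 <= N * N] and [d * N <= 6 * n] follows [2 * (c * d ^ 2) <= 36 * n ^ 2], whence the
     constant 18. *)
  rewrite -(leq_pmul2l (isT : 0 < 2)).
  apply: leq_trans (_ : (d * N) ^ 2 <= _).
    apply: leq_trans (_ : N * N * d ^ 2 <= _).
      by rewrite mulnA [2 * c]mulnC leq_mul2r cN orbT.
    by rewrite expnMn mulnC.
  apply: leq_trans (_ : (6 * n) ^ 2 <= _); first by rewrite leq_exp2r.
  by rewrite expnMn mulnA.
(* For [d <= 2] every vertex is its own class, and [c * 2 <= n * n] gives
   [c * d ^ 2 <= 2 * n ^ 2]. *)
have idP Z : ntcut e lam Z -> compat id Z by move=> _; apply/compatP=> x y ->.
have := leq_mul (nontrivial_min_cuts_le r minE idP) (leqnn 2).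
move/leq_trans/(_ (compat_cuts_bound r e_sym lam0 lamP id)).
rewrite -/c !(card_imset _ (@inj_id T)) -/n.
move=> cn; have {}cn : c * 2 <= n * n.
  by apply: leq_trans cn _; rewrite leq_mul2l leq_pred orbT.
apply: leq_trans (_ : c * 2 ^ 2 <= _); first by rewrite leq_mul2l leq_exp2r // d2 orbT.
rewrite expnS mulnA; apply: leq_trans (leq_mul cn (leqnn 2)) _.
by rewrite mulnC leq_mul.
Qed.

End Counting.

(** * The bounds over the rationals *)

Import Order.TTheory GRing.Theory Num.Theory.
Local Open Scope ring_scope.

Theorem corollary3 :
  exists C : rat, forall (T : finType) (e : rel T),
    simple_graph e -> connected_graph e -> (2 <= #|T|)%N ->
    (#|nontrivial_min_cuts e|%:R <= C * (#|T|%:R / (min_degree e)%:R) ^+ 2)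
    /\
    (#|min_cuts e|%:R <= #|T|%:R + C * (#|T|%:R / (min_degree e)%:R) ^+ 2).
Proof.
exists 18%:R => T e simple conn T2.
have [d0 bound] := nontrivial_min_cuts_bound simple conn T2.
have nt : #|nontrivial_min_cuts e|%:R
    <= 18%:R * (#|T|%:R / (min_degree e)%:R) ^+ 2 :> rat.
  rewrite expr_div_n mulrA ler_pdivlMr ?exprn_gt0 ?ltr0n //.
  by rewrite -!natrX -!natrM ler_nat.
split=> //; apply: le_trans (_ : (#|T| + #|nontrivial_min_cuts e|)%:R <= _).
  by rewrite ler_nat min_cuts_le.
by rewrite natrD lerD2l.
Qed.
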